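(* Let $n>1$. Let $Y$ be a space and $u_1,u_2\in\pi_n(Y)$ be elements of coprime finite orders. Put $w=\lfloor u_1+u_2\rfloor-\lfloor u_1\rfloor-\lfloor u_2\rfloor+\lfloor 0\rfloor\in H_0(Y^{S^n})$. Let $V$ be an abelian group and $f\colon\pi_n(Y)\to V$ be an invariant of finite degree. Then ${}^+f(w)=0$.
   Context: $\mathbb N=\{0,1,2,\dots\}$. ''Space'' means pointed topological space; ''map'' means basepoint-preserving continuous map; homotopies are pointed, $[X,Y]$ is the set of pointed homotopy classes of maps $X\to Y$, and $\pi_n(Y)=[S^n,Y]$. $Y^X$ is the space of maps $X\to Y$. $H_0(Y^{S^n})$ (integer coefficients) is the free abelian group on the set $\pi_n(Y)$; the basic element corresponding to $u\in\pi_n(Y)$ is denoted $\lfloor u\rfloor$. A function $f\colon\pi_n(Y)\to V$ to an abelian group gives the homomorphism ${}^+f\colon H_0(Y^{S^n})\to V$, $\lfloor u\rfloor\mapsto f(u)$. For a space $X$, $C_0(X)$ denotes the free abelian group on all points of $X$. A map $a\colon X\to Y$ and a number $r\in\mathbb N$ give the Cartesian power $a^r\colon X^r\to Y^r$ and the induced homomorphism $C_0(a^r)\colon C_0(X^r)\to C_0(Y^r)$. For an abelian group $V$, a function $f\colon[X,Y]\to V$ (called an invariant) has degree at most $r$ if and only if there is a homomorphism of abelian groups $l\colon\operatorname{Hom}(C_0(X^r),C_0(Y^r))\to V$ such that $f([a])=l(C_0(a^r))$ for all maps $a\colon X\to Y$. It has finite degree if it has degree at most $r$ for some $r\in\mathbb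 N$. *)

(* Defs.v *)
From HB Require Import structures.
From mathcomp Require Import all_boot all_order all_algebra generic_quotient.
From mathcomp Require Import all_classical all_reals topology normedtype.
From mathcomp.multinomials Require Import freeg.
From mathcomp Require Import lra.

Set Implicit Arguments.
Unset Strict Implicit.
Unset Printing Implicit Defensive.

Import Order.TTheory GRing.Theory Num.Theory.
Import numFieldTopology.Exports numFieldNormedType.Exports.

Local Open Scope classical_set_scope.
Local Open Scope ring_scope.
Local Open Scope quotient_scope.

Section PointedMaps.
Context (X Y : ptopologicalType).

Record pmap := PMap {
  pmap_fun :> X -> Y ;
  pmap_cts : continuous pmap_fun ;
  pmap_pt : pmap_fun point = point }.

HB.instance Definition _ := gen_eqMixin pmap.
HB.instance Definition _ := gen_choiceMixin pmap.

Lemma pmapP (a b : pmap) : a =1 b -> a = b.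
Proof.
case: a b => [a ca pa] [b cb pb] /= /funext ab; case: _ / ab in cb pb *.
by rewrite (Prop_irrelevance ca cb) (Prop_irrelevance pa pb).
Qed.

Definition cst_pmap : pmap := PMap (@cst_continuous X Y point) erefl.

End PointedMaps.

Lemma continuous_paste (T U : topologicalType) (A B : set T) (f g h : T -> U) :
  closed A -> closed B -> (forall x, A x \/ B x) ->
  continuous f -> continuous g ->
  (forall x, A x -> h x = f x) -> (forall x, B x -> h x = g x) ->
  continuous h.
Proof.
move=> cA cB AB cf cg hf hg; apply/continuous_subspace_setT.
have -> : [set: T] = A `|` B by apply/seteqP; split=> // x _; exact: AB.
apply: withinU_continuous => //.
- apply: (@subspace_eq_continuous _ A _ f); last exact: continuous_subspaceT.
  by move=> x /set_mem Ax; exact/esym/hf.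
- apply: (@subspace_eq_continuous _ B _ g); last exact: continuous_subspaceT.
  by move=> x /set_mem Bx; exact/esym/hg.
Qed.

Lemma continuous_pair (T U V : topologicalType) (f : T -> U) (g : T -> V) :
  continuous f -> continuous g -> continuous (fun x => (f x, g x)).
Proof. by move=> cf cg x; exact: (cvg_pair (cf x) (cg x)). Qed.

Lemma fst_continuous (T U : topologicalType) : continuous (@fst T U).
Proof. by move=> x; exact: cvg_fst. Qed.

Lemma snd_continuous (T U : topologicalType) : continuous (@snd T U).
Proof. by move=> x; exact: cvg_snd. Qed.

Lemma continuous_compose (T U V : topologicalType) (f : T -> U) (g : U -> V) :
  continuous f -> continuous g -> continuous (fun x => g (f x)).
Proof. by move=> cf cg x; exact: (continuous_comp (cf x) (cg (f x))). Qed.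

Section PointedHomotopy.
Context (R : realType) (X Y : ptopologicalType).

Definition phomotopic (a b : pmap X Y) : Prop :=
  exists H : X * R -> Y,
    [/\ {within setT `*` `[0, 1], continuous H},
        forall x, H (x, 0) = a x,
        forall x, H (x, 1) = b x &
        forall t, 0 <= t <= 1 -> H (point, t) = point].

Definition clamp (t : R) : R := Num.max 0 (Num.min t 1).

Lemma clamp_itv t : 0 <= clamp t <= 1.
Proof. by rewrite le_max lexx /= ge_max ler01 ge_min lexx orbT. Qed.

Lemma clamp_id t : 0 <= t <= 1 -> clamp t = t.
Proof. by move=> /andP[t0 t1]; rewrite /clamp (min_idPl t1) (max_idPr t0). Qed.

Lemma clamp_continuous : continuous clamp.
Proof.
move=> t; apply: (@continuous_max R R (cst 0) (fun t => Num.min t 1)).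
  exact: cvg_cst.
by apply: (@continuous_min R R id (cst 1)); [exact: cvg_id|exact: cvg_cst].
Qed.

(* A homotopy may be taken to be defined and continuous on the whole line. *)
Lemma phomotopicP (a b : pmap X Y) : phomotopic a b <->
  exists H : X * R -> Y,
    [/\ continuous H, forall x, H (x, 0) = a x, forall x, H (x, 1) = b x &
        forall t, H (point, t) = point].
Proof.
split=> [[H [cH H0 H1 Hp]]|[H [cH H0 H1 Hp]]]; last first.
  by exists H; split=> //; exact: continuous_subspaceT.
exists (fun z => H (z.1, clamp z.2)); split=> [z|x|x|t] /=.
- have gA (w : X * R) : (setT `*` `[0, 1]) (w.1, clamp w.2).
    by split=> //=; rewrite in_itv /= clamp_itv.
  have /subspace_continuousP/(_ _ (gA z)) := cH.
  apply: (cvg_comp (fun w : X * R => (w.1, clamp w.2)) H) => U.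
  have /(_ z) cg : continuous (fun w : X * R => (w.1, clamp w.2)).
    apply: continuous_pair; first exact: fst_continuous.
    exact: continuous_compose (@snd_continuous _ _) clamp_continuous.
  rewrite /within/= => /cg; apply: (@filterS _ (nbhs z)) => w UW.
  exact: UW (gA w).
- by rewrite clamp_id ?lexx ?ler01.
- by rewrite clamp_id ?lexx ?ler01.
- by rewrite Hp// clamp_itv.
Qed.

Lemma phomotopic_refl a : phomotopic a a.
Proof.
apply/phomotopicP; exists (fun z => a z.1); split=> //.
  exact: continuous_compose (@fst_continuous _ _) (@pmap_cts _ _ a).
by move=> t; exact: pmap_pt.
Qed.

Lemma reparam_continuous (H : X * R -> Y) (c d : R) :
  continuous H -> continuous (fun z => H (z.1, c * z.2 + d)).
Proof.
move=> cH; apply: (@continuous_compose _ _ _ (fun z => (z.1, c * z.2 + d)) H)=> //.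
apply: continuous_pair; first exact: fst_continuous.
move=> z; apply: cvgD; last exact: cvg_cst.
by apply: cvgM; [exact: cvg_cst|exact: cvg_snd].
Qed.

Lemma phomotopic_sym a b : phomotopic a b -> phomotopic b a.
Proof.
move=> /phomotopicP[H [cH H0 H1 Hp]]; apply/phomotopicP.
exists (fun z => H (z.1, -1 * z.2 + 1)); split=> /= [|x|x|t].
- exact: reparam_continuous.
- by rewrite mulr0 add0r.
- by rewrite mulr1 addNr.
- exact: Hp.
Qed.

Lemma phomotopic_trans b a c :
  phomotopic a b -> phomotopic b c -> phomotopic a c.
Proof.
move=> /phomotopicP[H [cH H0 H1 Hp]] /phomotopicP[K [cK K0 K1 Kp]].
apply/phomotopicP.
pose f z := H (z.1, 2 * z.2 + 0); pose g z := K (z.1, 2 * z.2 + -1).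
exists (fun z => if z.2 <= 2^-1 then f z else g z).
split=> /= [|x|x|t].
- apply: (@continuous_paste _ _ (snd @^-1` [set t : R | t <= 2^-1])
    (snd @^-1` [set t : R | 2^-1 <= t]) f g).
  + by move/continuous_closedP: (@snd_continuous X R); apply; exact: closed_le.
  + by move/continuous_closedP: (@snd_continuous X R); apply; exact: closed_ge.
  + by move=> z; apply/orP; exact: le_total.
  + exact: reparam_continuous.
  + exact: reparam_continuous.
  + by move=> z /= ->.
  + move=> [x t] /= ht; case: ifPn => // ht'.
    have -> : t = 2^-1 by apply: le_anti; rewrite ht ht'.
    rewrite /f /g /= (_ : 2 * 2^-1 + 0 = 1); last by lra.
    by rewrite (_ : 2 * 2^-1 + -1 = 0) ?H1 ?K0//; lra.
- by rewrite invr_ge0 ler0n /f /= mulr0 addr0 H0.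
- rewrite ifF; last by apply/negbTE; lra.
  by rewrite /g /= (_ : 2 * 1 + -1 = 1) ?K1//; lra.
- by case: ifP => _; [exact: Hp|exact: Kp].
Qed.

Definition phomotopic_rel (a b : pmap X Y) : bool := `[< phomotopic a b >].

Lemma phomotopic_rel_refl : reflexive phomotopic_rel.
Proof. by move=> a; apply/asboolP; exact: phomotopic_refl. Qed.

Lemma phomotopic_rel_sym : symmetric phomotopic_rel.
Proof.
by move=> a b; apply/asboolP/asboolP; exact: phomotopic_sym.
Qed.

Lemma phomotopic_rel_trans : transitive phomotopic_rel.
Proof.
move=> b a c /asboolP ab /asboolP bc; apply/asboolP.
exact: phomotopic_trans ab bc.
Qed.

Definition phomotopic_equiv :=
  EquivRel phomotopic_rel phomotopic_rel_refl phomotopic_rel_sym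
    phomotopic_rel_trans.

Definition hclasses := {eq_quot phomotopic_equiv}.

HB.instance Definition _ := EqQuotient.on hclasses.
HB.instance Definition _ := Choice.on hclasses.

Definition hclass (a : pmap X Y) : hclasses := \pi_hclasses a.

Lemma hclassP a b : hclass a = hclass b <-> phomotopic a b.
Proof. by split=> [/eqmodP/asboolP|h]//; apply/eqmodP/asboolP. Qed.

End PointedHomotopy.

Section Sphere.
Context (R : realType) (n : nat).

Definition cube_set : set 'rV[R]_n := [set x | forall i, 0 <= x 0 i <= 1].

Definition cube : Type := set_type cube_set.

HB.instance Definition _ := Topological.on cube.

Definition in_boundary (x : cube) : bool :=
  [exists i, (\val x 0 i == 0) || (\val x 0 i == 1)].

Lemma origin_in_cube : (0 : 'rV[R]_n) \in cube_set.
Proof. by apply/mem_set => i; rewrite mxE lexx ler01. Qed.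

HB.instance Definition _ := isPointed.Build cube (SigSub origin_in_cube).

Definition collapse_rel (x y : cube) : bool :=
  (x == y) || in_boundary x && in_boundary y.

Lemma collapse_rel_refl : reflexive collapse_rel.
Proof. by move=> x; rewrite /collapse_rel eqxx. Qed.

Lemma collapse_rel_sym : symmetric collapse_rel.
Proof. by move=> x y; rewrite /collapse_rel eq_sym andbC. Qed.

Lemma collapse_rel_trans : transitive collapse_rel.
Proof.
move=> y x z; rewrite /collapse_rel.
case/predU1P => [-> //|/andP[bx by_]] /predU1P[<-|/andP[_ bz]].
  by rewrite bx by_ orbT.
by rewrite bx bz orbT.
Qed.

Definition collapse_equiv :=
  EquivRel collapse_rel collapse_rel_refl collapse_rel_sym collapse_rel_trans.

(* S^n is modelled as I^n / dI^n, with the class of the boundary as basepoint.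
   For n = 0 the boundary is empty and this is a single point rather than S^0,
   so the model is meant for n >= 1. *)
Definition sphere_quot := {eq_quot collapse_equiv}.
Definition sphere : Type := quotient_topology sphere_quot.

HB.instance Definition _ := Quotient.on sphere.
HB.instance Definition _ := PointedTopological.on sphere.

Definition cube_proj (x : cube) : sphere := \pi_sphere x.

Lemma cube_projP x y :
  cube_proj x = cube_proj y <-> x = y \/ in_boundary x /\ in_boundary y.
Proof.
split=> [/eqmodP/predU1P[|/andP]|h]; [by left|by right|].
apply/eqmodP/predU1P; case: h => [|/andP]; [by left|by right].
Qed.

End Sphere.

Section HomotopyGroup.
Context (R : realType) (n : nat).
Local Notation cube := (cube R n).
Local Notation sphere := (sphere R n).

Definition on_first (phi : R -> R) (x : 'rV[R]_n) : 'rV[R]_n :=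
  \row_i if i == 0%N :> nat then phi (x 0 i) else x 0 i.

Definition left_stretch (t : R) : R := Num.min (2 * t) 1.
Definition right_stretch (t : R) : R := Num.max (2 * t - 1) 0.

Lemma on_first_in_cube phi (x : cube) :
  (forall t, 0 <= t <= 1 -> 0 <= phi t <= 1) ->
  on_first phi (\val x) \in @cube_set R n.
Proof.
move=> hphi; apply/mem_set => i; rewrite mxE.
by have := set_mem (valP x) i; case: ifP => // _; exact: hphi.
Qed.

Lemma left_stretch_itv t : 0 <= t <= 1 -> 0 <= left_stretch t <= 1.
Proof. by rewrite /left_stretch; case: (leP (2 * t) 1) => ?; lra. Qed.

Lemma right_stretch_itv t : 0 <= t <= 1 -> 0 <= right_stretch t <= 1.
Proof. by rewrite /right_stretch; case: (leP (2 * t - 1) 0) => ?; lra. Qed.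

Definition left_cube (x : cube) : cube :=
  SigSub (on_first_in_cube x left_stretch_itv).
Definition right_cube (x : cube) : cube :=
  SigSub (on_first_in_cube x right_stretch_itv).

Definition in_left_half (x : cube) : bool :=
  [forall i : 'I_n, (i == 0%N :> nat) ==> (\val x 0 i <= 2^-1)].

(* The usual sum of two maps out of I^n / dI^n: for x = (x_1, ..., x_n) it is
   a (2 x_1, x_2, ..., x_n) if x_1 <= 1/2 and b (2 x_1 - 1, x_2, ..., x_n)
   otherwise, see pcat_proj. *)
Definition pcat_fun (Y : Type) (a b : sphere -> Y) (s : sphere) : Y :=
  let x : cube := repr s in
  if in_left_half x then a (cube_proj (left_cube x))
  else b (cube_proj (right_cube x)).

Definition left_sphere (s : sphere) : sphere := cube_proj (left_cube (repr s)).
Definition right_sphere (s : sphere) : sphere :=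
  cube_proj (right_cube (repr s)).

Lemma on_first_continuous phi :
  continuous phi -> continuous (on_first phi).
Proof.
move=> cphi x U [P hP sPU]; apply: (@filterS _ (nbhs x) _
    (fun y => forall i j, P i j (on_first phi y i j))).
  by move=> y hy; exact: sPU.
apply: (@filter_forall _ _ (fun i y => forall j, P i j (on_first phi y i j))
  (nbhs x)) => i.
apply: (@filter_forall _ _ (fun j y => P i j (on_first phi y i j))
  (nbhs x)) => j.
have [j0|j0] := eqVneq (j : nat) 0%N.
- have := hP i j; rewrite mxE j0 eqxx => hPij.
  have cc := continuous_compose (@coord_continuous R 1 n 0 j) cphi.
  have /(_ _ hPij) := cc x.
  by apply: (@filterS _ (nbhs x)) => y /=; rewrite mxE j0 eqxx.
- have := hP i j; rewrite mxE (negbTE j0) => hPij.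
  have /(_ _ hPij) := @coord_continuous R 1 n 0 j x.
  by apply: (@filterS _ (nbhs x)) => y /=; rewrite mxE (negbTE j0).
Qed.

Lemma left_stretch_continuous : continuous left_stretch.
Proof.
move=> t; apply: (@continuous_min R R (fun t => 2 * t) (cst 1)).
  by apply: cvgM; [exact: cvg_cst|exact: cvg_id].
exact: cvg_cst.
Qed.

Lemma right_stretch_continuous : continuous right_stretch.
Proof.
move=> t; apply: (@continuous_max R R (fun t => 2 * t - 1) (cst 0)).
  apply: cvgB; last exact: cvg_cst.
  by apply: cvgM; [exact: cvg_cst|exact: cvg_id].
exact: cvg_cst.
Qed.

Lemma cube_val_continuous : continuous (\val : cube -> 'rV[R]_n).
Proof. exact: initial_continuous. Qed.

Lemma into_cube_continuous (T : topologicalType) (f : T -> cube) :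
  continuous (fun x => \val (f x)) -> continuous f.
Proof. exact: continuous_comp_initial. Qed.

Lemma cube_proj_continuous : continuous (@cube_proj R n).
Proof. exact: pi_continuous. Qed.

Lemma cube_proj_boundary (x : cube) :
  in_boundary x -> cube_proj x = point :> sphere.
Proof.
move=> /existsP[i hi]; apply/cube_projP; right.
split; apply/existsP; exists i => //.
by rewrite /point /= mxE eqxx.
Qed.

Lemma from_sphere_continuous (T : topologicalType) (f : cube -> T) :
  continuous f ->
  (forall x y, in_boundary x -> in_boundary y -> f x = f y) ->
  continuous (fun s : sphere => f (repr s)) /\
  forall x, f (repr (cube_proj x)) = f x.
Proof.
move=> cf hf.
have E x : f (repr (cube_proj x)) = f x.
  have /cube_projP : cube_proj (repr (cube_proj x)) = cube_proj x.
    exact: reprK.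
  by case=> [->|[bx bx']]//; exact: hf.
split=> //; apply/quotient_continuous.
by rewrite (_ : _ \o _ = f)//; apply/funext => x; exact: E.
Qed.

Lemma on_first_boundary phi (x : cube) (hx : on_first phi (\val x) \in @cube_set R n) :
  phi 0 = 0 -> phi 1 = 1 -> in_boundary x ->
  in_boundary (SigSub hx : cube).
Proof.
move=> phi0 phi1 /existsP[i hi]; apply/existsP; exists i; rewrite /= mxE.
by case: ifP => // _; case/orP: hi => /eqP ->; rewrite ?phi0 ?phi1 eqxx ?orbT.
Qed.

Lemma left_cube_boundary x : in_boundary x -> in_boundary (left_cube x).
Proof.
apply: on_first_boundary; rewrite /left_stretch.
  by rewrite mulr0 (min_idPl _)// ler01.
by rewrite (min_idPr _)//; lra.
Qed.

Lemma right_cube_boundary x : in_boundary x -> in_boundary (right_cube x).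
Proof.
apply: on_first_boundary; rewrite /right_stretch.
  by rewrite (max_idPr _)//; lra.
by rewrite (_ : 2 * 1 - 1 = 1) ?(max_idPl _)//; lra.
Qed.

Lemma left_cube_continuous : continuous left_cube.
Proof.
apply: into_cube_continuous.
exact: continuous_compose cube_val_continuous
  (on_first_continuous left_stretch_continuous).
Qed.

Lemma right_cube_continuous : continuous right_cube.
Proof.
apply: into_cube_continuous.
exact: continuous_compose cube_val_continuous
  (on_first_continuous right_stretch_continuous).
Qed.

Lemma left_sphere_spec : continuous left_sphere /\
  forall x, left_sphere (cube_proj x) = cube_proj (left_cube x).
Proof.
apply: (@from_sphere_continuous _ (fun x => cube_proj (left_cube x))).
  exact: continuous_compose left_cube_continuous cube_proj_continuous.
by move=> x y bx by_; rewrite !cube_proj_boundary ?left_cube_boundary.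
Qed.

Lemma right_sphere_spec : continuous right_sphere /\
  forall x, right_sphere (cube_proj x) = cube_proj (right_cube x).
Proof.
apply: (@from_sphere_continuous _ (fun x => cube_proj (right_cube x))).
  exact: continuous_compose right_cube_continuous cube_proj_continuous.
by move=> x y bx by_; rewrite !cube_proj_boundary ?right_cube_boundary.
Qed.

Lemma sphere_pointE : point = cube_proj point :> sphere. Proof. by []. Qed.

Lemma origin_boundary0 (x : cube) : n = 0%N -> cube_proj x = point :> sphere.
Proof.
move=> n0; rewrite sphere_pointE; congr cube_proj; apply: val_inj.
by apply/rowP => i; have := ltn_ord i; rewrite {2}n0.
Qed.

Lemma right_cube_left_half (x : cube) :
  in_left_half x -> cube_proj (right_cube x) = point :> sphere.
Proof.
have [n0 _|n0 /forallP h] := posnP n; first exact: origin_boundary0.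
apply: cube_proj_boundary; apply/existsP; exists (Ordinal n0); rewrite /= mxE /=.
have /= h0 := h (Ordinal n0).
by rewrite /right_stretch (max_idPr _) ?eqxx//; lra.
Qed.

Lemma left_cube_right_half (x : cube) :
  ~~ in_left_half x -> cube_proj (left_cube x) = point :> sphere.
Proof.
rewrite negb_forall => /existsP[i]; rewrite negb_imply -ltNge => /andP[i0 hi].
apply: cube_proj_boundary; apply/existsP; exists i; rewrite /= mxE i0.
by rewrite /left_stretch (min_idPr _) ?eqxx ?orbT//; lra.
Qed.

Lemma left_sphere_pt : left_sphere point = point.
Proof.
rewrite {1}sphere_pointE left_sphere_spec.2.
have [n0|n0] := posnP n; first exact: origin_boundary0.
apply/cube_proj_boundary/left_cube_boundary/existsP.
by exists (Ordinal n0); rewrite /point /= mxE eqxx.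
Qed.

Lemma right_sphere_pt : right_sphere point = point.
Proof.
rewrite {1}sphere_pointE right_sphere_spec.2.
have [n0|n0] := posnP n; first exact: origin_boundary0.
apply/cube_proj_boundary/right_cube_boundary/existsP.
by exists (Ordinal n0); rewrite /point /= mxE eqxx.
Qed.

Lemma closed_sphere_point : closed [set point : sphere].
Proof.
rewrite -openC; rewrite /open /= /quotient_open.
have [n0|n0] := posnP n.
  rewrite (_ : _ @^-1` _ = set0); first exact: open0.
  by apply/seteqP; split=> // x /=; apply; exact: origin_boundary0.
rewrite -[X in open X]setCK openC.
have -> : ~` (\pi_(sphere_quot R n) @^-1` ~` [set (point : sphere)]) =
    \bigcup_(i in [set: 'I_n])
      ((fun x : cube => \val x 0 i) @^-1` [set t | t = 0] `|`
       (fun x : cube => \val x 0 i) @^-1` [set t | t = 1]).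
  apply/seteqP; split=> x /=.
    move=> /contrapT; rewrite [point]sphere_pointE => /cube_projP h.
    have /existsP[i /orP hi] : in_boundary x.
      case: h => [->|[]//]; apply/existsP; exists (Ordinal n0).
      by rewrite /point /= mxE eqxx.
    by exists i => //; case: hi => /eqP; [left|right].
  case=> i _ hi; apply; apply: cube_proj_boundary.
  by apply/existsP; exists i; case: hi => /= ->; rewrite eqxx ?orbT.
apply: closed_bigcup => [|i _]; first exact: finite_finset.
have ci : continuous (fun x : cube => \val x 0 i).
  exact: continuous_compose cube_val_continuous (@coord_continuous R 1 n 0 i).
by apply: closedU; move/continuous_closedP: ci; apply; exact: closed_eq.
Qed.

Lemma pcat_fun_left (Y : Type) (a b : sphere -> Y) s :
  a point = b point -> right_sphere s = point ->
  pcat_fun a b s = a (left_sphere s).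
Proof.
rewrite /pcat_fun => ab hs; case: ifPn => // /left_cube_right_half hl.
by rewrite -/(right_sphere s) hs /left_sphere hl ab.
Qed.

Lemma pcat_fun_right (Y : Type) (a b : sphere -> Y) s :
  a point = b point -> left_sphere s = point ->
  pcat_fun a b s = b (right_sphere s).
Proof.
rewrite /pcat_fun => ab hs; case: ifPn => // /right_cube_left_half hr.
by rewrite -/(left_sphere s) hs /right_sphere hr ab.
Qed.

Lemma left_or_right s : right_sphere s = point \/ left_sphere s = point.
Proof.
have [h|h] := boolP (in_left_half (repr s)); [left|right].
  exact: right_cube_left_half.
exact: left_cube_right_half.
Qed.

Context (Y : ptopologicalType).

Lemma pcat_cts (a b : pmap sphere Y) : continuous (pcat_fun a b).
Proof.
have ab : a point = b point by rewrite !pmap_pt.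
apply: (@continuous_paste _ _ (right_sphere @^-1` [set point])
    (left_sphere @^-1` [set point]) (fun s => a (left_sphere s))
    (fun s => b (right_sphere s))).
- move/continuous_closedP: right_sphere_spec.1; apply.
  exact: closed_sphere_point.
- move/continuous_closedP: left_sphere_spec.1; apply.
  exact: closed_sphere_point.
- exact: left_or_right.
- exact: continuous_compose left_sphere_spec.1 (@pmap_cts _ _ a).
- exact: continuous_compose right_sphere_spec.1 (@pmap_cts _ _ b).
- by move=> s; exact: pcat_fun_left.
- by move=> s; exact: pcat_fun_right.
Qed.

Lemma pcat_pt (a b : pmap sphere Y) : pcat_fun a b point = point.
Proof.
rewrite pcat_fun_left ?pmap_pt ?right_sphere_pt//.
by rewrite left_sphere_pt pmap_pt.
Qed.

Definition pcat (a b : pmap sphere Y) : pmap sphere Y :=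
  PMap (@pcat_cts a b) (pcat_pt a b).

Lemma pcat_proj (a b : pmap sphere Y) (x : cube) :
  pcat a b (cube_proj x) =
  if in_left_half x then a (cube_proj (left_cube x))
  else b (cube_proj (right_cube x)).
Proof.
have ab : a point = b point by rewrite !pmap_pt.
case: ifPn => h /=.
  rewrite pcat_fun_left ?left_sphere_spec.2 ?right_sphere_spec.2//.
  exact: right_cube_left_half.
rewrite pcat_fun_right ?left_sphere_spec.2 ?right_sphere_spec.2//.
exact: left_cube_right_half.
Qed.

Lemma phomotopic_pcat (a a' b b' : pmap sphere Y) :
  phomotopic R a a' -> phomotopic R b b' ->
  phomotopic R (pcat a b) (pcat a' b').
Proof.
move=> /phomotopicP[H [cH H0 H1 Hp]] /phomotopicP[K [cK K0 K1 Kp]].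
have HK t : H (point, t) = K (point, t) by rewrite Hp Kp.
apply/phomotopicP; exists (fun z =>
  pcat_fun (fun s => H (s, z.2)) (fun s => K (s, z.2)) z.1).
split=> [|x|x|t] /=.
- apply: (@continuous_paste _ _ (fst @^-1` (right_sphere @^-1` [set point]))
    (fst @^-1` (left_sphere @^-1` [set point]))
    (fun z => H (left_sphere z.1, z.2))
    (fun z => K (right_sphere z.1, z.2))).
  + move/continuous_closedP: (@fst_continuous sphere R); apply.
    move/continuous_closedP: right_sphere_spec.1; apply.
    exact: closed_sphere_point.
  + move/continuous_closedP: (@fst_continuous sphere R); apply.
    move/continuous_closedP: left_sphere_spec.1; apply.
    exact: closed_sphere_point.
  + by move=> z; exact: left_or_right.
  + apply: continuous_compose cH; apply: continuous_pair.
      exact: continuous_compose (@fst_continuous _ _) left_sphere_spec.1.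
    exact: snd_continuous.
  + apply: continuous_compose cK; apply: continuous_pair.
      exact: continuous_compose (@fst_continuous _ _) right_sphere_spec.1.
    exact: snd_continuous.
  + by move=> z hz; rewrite pcat_fun_left.
  + by move=> z hz; rewrite pcat_fun_right.
- by congr pcat_fun; apply/funext.
- by congr pcat_fun; apply/funext.
- by rewrite pcat_fun_left ?right_sphere_pt// left_sphere_pt.
Qed.

Definition homotopy_group := hclasses R sphere Y.

HB.instance Definition _ := Choice.on homotopy_group.

Definition hg_zero : homotopy_group := hclass R (cst_pmap sphere Y).

Definition hg_add (u v : homotopy_group) : homotopy_group :=
  hclass R (pcat (repr u) (repr v)).

Lemma hg_addE (a b : pmap sphere Y) :
  hg_add (hclass R a) (hclass R b) = hclass R (pcat a b).
Proof.
by apply/hclassP/phomotopic_pcat; apply/hclassP; exact: reprK.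
Qed.

(* The m-fold sum u + (u + ... (u + 0)). *)
Definition hg_natmul (u : homotopy_group) (m : nat) : homotopy_group :=
  iter m (hg_add u) hg_zero.

Definition hg_has_order (u : homotopy_group) (m : nat) : Prop :=
  [/\ (0 < m)%N, hg_natmul u m = hg_zero &
      forall k, (0 < k < m)%N -> hg_natmul u k <> hg_zero].

End HomotopyGroup.

Section Hom.
Context (A B : zmodType).

Definition hom : Type := {additive A -> B}.

HB.instance Definition _ := gen_eqMixin hom.
HB.instance Definition _ := gen_choiceMixin hom.

Definition hom_fun (f : hom) : A -> B := (f : {additive A -> B}).

Lemma homP (f g : hom) : hom_fun f =1 hom_fun g -> f = g.
Proof.
rewrite /hom_fun; case: f g => [f [[hf]]] [g [[hg]]] /= /funext fg.
by case: _ / fg in hg *; rewrite (Prop_irrelevance hf hg).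
Qed.

(* Pointwise operations; see hom_addE. *)
Definition hom_zero : hom := (\0 : A -> B)%FUN.
Definition hom_opp (f : hom) : hom := (\- hom_fun f)%FUN.
Definition hom_add (f g : hom) : hom := (hom_fun f \+ hom_fun g)%FUN.

Lemma hom_addA : associative hom_add.
Proof. by move=> f g h; apply: homP => x; exact: addrA. Qed.
Lemma hom_addC : commutative hom_add.
Proof. by move=> f g; apply: homP => x; exact: addrC. Qed.
Lemma hom_add0 : left_id hom_zero hom_add.
Proof. by move=> f; apply: homP => x; exact: add0r. Qed.
Lemma hom_addN : left_inverse hom_zero hom_opp hom_add.
Proof. by move=> f; apply: homP => x; exact: addNr. Qed.

HB.instance Definition _ :=
  GRing.isZmodule.Build hom hom_addA hom_addC hom_add0 hom_addN.

Lemma hom_addE (f g : hom) x : hom_fun (f + g) x = hom_fun f x + hom_fun g x.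
Proof. by []. Qed.

Lemma hom_zeroE x : hom_fun 0 x = 0. Proof. by []. Qed.

Lemma hom_oppE (f : hom) x : hom_fun (- f) x = - hom_fun f x.
Proof. by []. Qed.

End Hom.

Section FreeAbelian.

(* The homomorphism from the free abelian group on K extending f. *)
Definition freeg_ext (K : choiceType) (V : zmodType) (f : K -> V) :
  {freeg K / int} -> V := fglift (f : K -> zmodule V).

Lemma freeg_ext_additive (K : choiceType) (V : zmodType) (f : K -> V) :
  zmod_morphism (freeg_ext f).
Proof. exact: (@lift_is_additive int K (zmodule V) f). Qed.

HB.instance Definition _ (K : choiceType) (V : zmodType) (f : K -> V) :=
  GRing.isZmodMorphism.Build {freeg K / int} V (freeg_ext f)
    (freeg_ext_additive f).

Lemma freeg_ext1 (K : choiceType) (V : zmodType) (f : K -> V) u :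
  freeg_ext f (<< u >> : {freeg K / int}) = f u.
Proof. by rewrite /freeg_ext liftU scale1r. Qed.

(* Only the underlying set of points of X matters. *)
Definition C0 (X : choiceType) : zmodType := {freeg X / int}.

Definition C0_map (X Y : choiceType) (a : X -> Y) : hom (C0 X) (C0 Y) :=
  freeg_ext (fun x => << a x >> : {freeg Y / int}).

Lemma C0_map1 (X Y : choiceType) (a : X -> Y) (x : X) :
  hom_fun (C0_map a) (<< x >> : {freeg X / int}) = << a x >> :> C0 Y.
Proof. exact: freeg_ext1. Qed.

Definition power_map (X Y : Type) (r : nat) (a : X -> Y)
    (x : {ffun 'I_r -> X}) : {ffun 'I_r -> Y} := [ffun i => a (x i)].

Context (R : realType) (X Y : ptopologicalType) (V : zmodType).

Definition degree_le (f : hclasses R X Y -> V) (r : nat) : Prop :=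
  exists l : {additive
      hom (C0 {ffun 'I_r -> X}) (C0 {ffun 'I_r -> Y}) -> V},
    forall a : pmap X Y, f (hclass R a) = l (C0_map (@power_map X Y r a)).

Definition finite_degree (f : hclasses R X Y -> V) : Prop :=
  exists r : nat, degree_le f r.

End FreeAbelian.

(* Main.v *)
Require Import Defs.
From HB Require Import structures.
From mathcomp Require Import all_boot all_order all_algebra.
From mathcomp Require Import all_classical all_reals topology normedtype.
From mathcomp.multinomials Require Import freeg.
From mathcomp Require Import lra zify.

(** Divide the sphere into k + l bands and let a map be a on the first k bands
    and b on the others, or constant on some of them.  A family of r < k + l
    points misses a band, so the alternating sum of C_0(a_S^r) over the subsets
    S of bands vanishes.  Hence g(i, j) = f (i u1 + j u2) has vanishing mixed
    differences c(k, l) of total order k + l > r at the origin.  If all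
    c(k', l) with k' > k vanish, then the l-th difference of g in j has an
    affine (k - 1)-th difference in i, of slope c(k, l), which is m1-periodic,
    so m1 c(k, l) = 0; likewise m2 c(k, l) = 0.  By descending induction on
    k + l, c(k, l) = 0 for k, l >= 1; the claim is c(1, 1) = 0.  *)

Set Implicit Arguments.
Unset Strict Implicit.
Unset Printing Implicit Defensive.

Import Order.TTheory GRing.Theory Num.Theory.
Import numFieldTopology.Exports numFieldNormedType.Exports.
Import Defs.

Local Open Scope ring_scope.

(** * Unit laws for the sum of homotopy classes *)

Section UnitLaws.
Context (R : realType) (n : nat).
Local Notation cube := (cube R n).
Local Notation sphere := (sphere R n).

(* The exponential law replaces the fact that a quotient map times the identity
   of a locally compact space is a quotient map. *)
Lemma sphere_line_continuous (T : topologicalType) (H : sphere * R -> T) :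
  continuous (fun z : cube * R => H (cube_proj z.1, z.2)) -> continuous H.
Proof.
move=> cH; have -> : H = uncurry (curry H) by apply/funext => -[].
pose K (s : sphere) : {compact-open, R -> T} := curry H s.
have /continuous_curry[cK cK1] := cH.
have cts_K : continuous K.
  apply/quotient_continuous; exact: cK.
apply: (@continuous_uncurry sphere R T K) => //.
- exact: locally_compactR.
- move=> s t; rewrite -[s]reprK; exact: cK1.
Qed.

(** The straight-line homotopy from the identity to [psi] in the first coordinate stays in [0, 1] by
    convexity and fixes 0 and 1, so it preserves the boundary of the cube and descends to the
    sphere. *)
Lemma stretch_phomotopic (Y : ptopologicalType) (psi : R -> R)
    (psi_itv : forall t, 0 <= t <= 1 -> 0 <= psi t <= 1)
    (a b : pmap sphere Y) :
  continuous psi -> psi 0 = 0 -> psi 1 = 1 ->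
  (forall x : cube,
     b (cube_proj x) = a (cube_proj (SigSub (on_first_in_cube x psi_itv)))) ->
  phomotopic R a b.
Proof.
move=> cpsi psi0 psi1 ab.
pose phi (t x : R) := x + clamp t * (psi x - x).
have phi_itv t x : 0 <= x <= 1 -> 0 <= phi t x <= 1.
  move=> hx; rewrite /phi; have := psi_itv x hx; have := clamp_itv t; nra.
pose G (z : cube * R) : cube := SigSub (on_first_in_cube z.1 (phi_itv z.2)).
have cG : continuous G.
  apply: into_cube_continuous.
  rewrite (_ : (fun _ => _) = (fun z : cube * R =>
     \val z.1 + clamp z.2 *: (on_first psi (\val z.1) - \val z.1))); last first.
    apply/funext => z; apply/rowP => i; rewrite !mxE /=.
    by case: ifP => // _; rewrite subrr mulr0 addr0.
  have cv : continuous (fun z : cube * R => \val z.1).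
    exact: continuous_compose (@fst_continuous _ _) (@cube_val_continuous R n).
  have co : continuous (fun z : cube * R => on_first psi (\val z.1)).
    exact: continuous_compose cv (on_first_continuous cpsi).
  have cc : continuous (fun z : cube * R => clamp z.2).
    exact: continuous_compose (@snd_continuous _ _) (@clamp_continuous R).
  move=> z; apply: cvgD; first exact: cv.
  by apply: cvgZ; [exact: cc|apply: cvgB; [exact: co|exact: cv]].
have G_boundary x t : in_boundary x -> in_boundary (G (x, t)).
  by apply: on_first_boundary; rewrite /phi ?psi0 ?psi1 subrr mulr0 addr0.
pose H (z : sphere * R) := a (cube_proj (G (repr z.1, z.2))).
have HE x t : H (cube_proj x, t) = a (cube_proj (G (x, t))).
  rewrite /H /=.
  have /cube_projP : cube_proj (repr (cube_proj x)) = cube_proj x.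
    exact: reprK.
  case=> [->//|[bx bx']].
  by rewrite (cube_proj_boundary (G_boundary _ t bx))
    (cube_proj_boundary (G_boundary _ t bx')).
apply/phomotopicP; exists H; split=> [|s|s|t].
- apply: sphere_line_continuous.
  rewrite (_ : (fun _ => _) = fun z => a (cube_proj (G z))); last first.
    by apply/funext => -[x t]; exact: HE.
  have ca := continuous_compose (@cube_proj_continuous R n) (@pmap_cts _ _ a).
  exact: (continuous_compose cG ca).
- rewrite -[s]reprK -/(cube_proj _) HE; congr (a (cube_proj _)).
  apply: val_inj; apply/rowP => i; rewrite mxE /phi clamp_id ?lexx ?ler01//.
  by rewrite mul0r addr0 if_same.
- rewrite -[s]reprK -/(cube_proj _) HE ab; congr (a (cube_proj _)).
  apply: val_inj; apply/rowP => i; rewrite !mxE /phi clamp_id ?lexx ?ler01//.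
  by rewrite mul1r addrC subrK.
(* For n = 0 the boundary is empty, but the sphere is then a single point. *)
- have [n0|n0] := posnP n; first by rewrite /H origin_boundary0// pmap_pt.
  rewrite sphere_pointE HE cube_proj_boundary ?pmap_pt// G_boundary//.
  by apply/existsP; exists (Ordinal n0); rewrite /point /= mxE eqxx.
Qed.

Context (Y : ptopologicalType).

(** [right_stretch] sends the left half of the cube into the boundary, so precomposing [b] with it
    gives exactly the sum on the right. *)
Lemma pcat_cstl (b : pmap sphere Y) :
  phomotopic R b (pcat (cst_pmap sphere Y) b).
Proof.
apply: (stretch_phomotopic (psi_itv := @right_stretch_itv R)) => [|||x].
- exact: right_stretch_continuous.
- by rewrite /right_stretch (max_idPr _)//; lra.
- by rewrite /right_stretch (max_idPl _)//; lra.
rewrite pcat_proj -/(right_cube x); case: ifP => //.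
by move=> /right_cube_left_half ->; rewrite pmap_pt.
Qed.

Lemma pcat_cstr (a : pmap sphere Y) :
  phomotopic R a (pcat a (cst_pmap sphere Y)).
Proof.
apply: (stretch_phomotopic (psi_itv := @left_stretch_itv R)) => [|||x].
- exact: left_stretch_continuous.
- by rewrite /left_stretch (min_idPl _)//; lra.
- by rewrite /left_stretch (min_idPr _)//; lra.
rewrite pcat_proj -/(left_cube x); case: ifPn => //.
by move=> /left_cube_right_half ->; rewrite pmap_pt.
Qed.

Lemma hg_add0r (u : homotopy_group R n Y) : hg_add (hg_zero R n Y) u = u.
Proof.
rewrite -[u]reprK -/(hclass R _) hg_addE.
by apply/hclassP/phomotopic_sym/pcat_cstl.
Qed.

Lemma hg_addr0 (u : homotopy_group R n Y) : hg_add u (hg_zero R n Y) = u.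
Proof.
rewrite -[u]reprK -/(hclass R _) hg_addE.
by apply/hclassP/phomotopic_sym/pcat_cstr.
Qed.

End UnitLaws.

(** * Alternating sums over words in two self-maps *)

Section Cross.
Context (T : Type) (c d : T -> T) (z : T).

(* The sum over all words of length k in c and d, with sign (-1)^(number of d),
   of the values of F at the image of z under the word. *)
Fixpoint cross (V : zmodType) (k : nat) (F : T -> V) : V :=
  if k is k'.+1 then cross k' (F \o c) - cross k' (F \o d) else F z.

Lemma eq_cross (V : zmodType) k (F G : T -> V) :
  F =1 G -> cross k F = cross k G.
Proof. by move=> /funext ->. Qed.

Lemma raddf_cross (U V : zmodType) (l : {additive U -> V}) k (F : T -> U) :
  l (cross k F) = cross k (l \o F).
Proof. by elim: k F => [|k IH] F //=; rewrite raddfB !IH. Qed.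

Lemma cross0 (V : zmodType) k : cross k (fun=> 0 : V) = 0.
Proof. by elim: k => [|k IH] //=; rewrite IH subr0. Qed.

Lemma crossB (V : zmodType) k (F G : T -> V) :
  cross k (fun x => F x - G x) = cross k F - cross k G.
Proof.
elim: k F G => [|k IH] F G //=.
rewrite (IH (F \o c) (G \o c)) (IH (F \o d) (G \o d)).
by rewrite opprD addrACA -opprD.
Qed.

End Cross.

(** Serves to pass from maps to homotopy classes, and from natural numbers to the multiples of a
    class. *)
Lemma cross_morph (T T' : Type) (c d : T -> T) (z : T) (c' d' : T' -> T')
    (h : T -> T') (V : zmodType) k (F : T' -> V) :
  (forall x, h (c x) = c' (h x)) -> (forall x, h (d x) = d' (h x)) ->
  cross c d z k (F \o h) = cross c' d' (h z) k F.
Proof.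
move=> hc hd; elim: k F => [|k IH] F //=; rewrite -!IH.
by congr (_ - _); apply: eq_cross => x /=; rewrite ?hc ?hd.
Qed.

(** * Finite differences in one and two variables *)

Section FiniteDifferences.
Context (V : zmodType).

Definition delta (h : nat -> V) (i : nat) : V := h i.+1 - h i.

Lemma cross_nat k (h : nat -> V) : cross S id 0%N k h = iter k delta h 0%N.
Proof.
elim: k h => [|k IH] h //; rewrite iterSr -IH /= -crossB.
exact: eq_cross.
Qed.

Lemma deltaB_iter k (h h' : nat -> V) i :
  iter k delta (fun i => h i - h' i) i = iter k delta h i - iter k delta h' i.
Proof.
by elim: k i => [|k IH] i //=; rewrite /delta !IH opprD addrACA -opprD.
Qed.

(** The hypothesis passes from [h] to [delta h], hence an induction on [m] for all [h] at once. *)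
Lemma delta_const (h : nat -> V) :
  (forall k, iter k.+1 delta h 0%N = 0) -> forall m, h m = h 0%N.
Proof.
move=> h0 m; elim: m h h0 => [|m IH] h h0 //.
rewrite -[h m.+1](subrK (h m)) -/(delta h m) (IH h h0) (IH (delta h)).
  by have /= -> := h0 0%N; rewrite add0r.
by move=> k; rewrite -iterSr.
Qed.

Lemma delta_affine (h : nat -> V) :
  (forall k, iter k.+2 delta h 0%N = 0) ->
  forall m, h m = h 0%N + delta h 0%N *+ m.
Proof.
move=> h0; elim=> [|m IH]; first by rewrite mulr0n addr0.
rewrite -[h m.+1](subrK (h m)) -/(delta h m) IH (@delta_const (delta h)).
  by rewrite mulrS addrCA.
by move=> k; rewrite -iterSr.
Qed.

Lemma delta_exchange k l (g : nat -> nat -> V) i j :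
  iter k delta (fun i => iter l delta (g i) j) i =
  iter l delta (fun j => iter k delta (g ^~ j) i) j.
Proof.
elim: k i => [|k IH] i //=; rewrite /delta !IH.
by rewrite -deltaB_iter.
Qed.

(** The c(k, l) of the overview. *)
Definition mixed (g : nat -> nat -> V) k l :=
  iter k delta (fun i => iter l delta (g i) 0%N) 0%N.

Lemma periodic_delta k (h : nat -> V) m :
  (forall i, h (m + i)%N = h i) ->
  forall i, iter k delta h (m + i)%N = iter k delta h i.
Proof.
by move=> hp; elim: k => [|k IH] i //=; rewrite /delta -addnS !IH.
Qed.

Lemma mixed_torsion (g : nat -> nat -> V) m k l :
  (forall i j, g (m + i)%N j = g i j) ->
  (forall k', (k < k')%N -> mixed g k'.+1 l = 0) ->
  mixed g k.+1 l *+ m = 0.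
Proof.
move=> gp hk; pose h := iter k delta (fun i => iter l delta (g i) 0%N).
have hm : h (m + 0)%N = h 0%N.
  apply: periodic_delta => i; congr (iter l delta _ 0%N).
  by apply/funext => j; exact: gp.
(* The slope [delta h 0] is [mixed g k.+1 l], so [h m = h 0] reads as the claim. *)
move: hm; rewrite addn0 (delta_affine (h := h)) => [|k'].
  by rewrite -[RHS]addr0 => /addrI.
by rewrite -iterD !addSn; apply: (hk (k' + k).+1); rewrite ltnS leq_addl.
Qed.

Lemma mixed_exchange (g : nat -> nat -> V) k l :
  mixed g k l = mixed (fun i j => g j i) l k.
Proof. exact: delta_exchange. Qed.

Lemma mixed_coprime_eq0 (g : nat -> nat -> V) m1 m2 r :
  coprime m1 m2 ->
  (forall i j, g (m1 + i)%N j = g i j) ->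
  (forall i j, g i (m2 + j)%N = g i j) ->
  (forall k l, (r < k + l)%N -> mixed g k l = 0) ->
  forall k l, mixed g k.+1 l.+1 = 0.
Proof.
move=> cop g1 g2 gr k l.
have [d] := ubnP (r - (k + l))%N; elim: d k l => // d IH k l hd.
(* In the remaining case k + l < r, so the truncated difference r - (k + l) drops strictly when [k]
   or [l] grows. *)
have [hr|hr] := ltnP r (k.+1 + l.+1); first exact: gr.
have t1 : mixed g k.+1 l.+1 *+ m1 = 0.
  by apply: mixed_torsion => // k' hk; apply: IH; lia.
have t2 : mixed g k.+1 l.+1 *+ m2 = 0.
  rewrite mixed_exchange; apply: mixed_torsion => [i j|l' hl]; first exact: g2.
  by rewrite -mixed_exchange; apply: IH; lia.
have [m10|m1_gt0] := posnP m1.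
  by move: t2; rewrite (_ : m2 = 1%N)//; move: cop;
    rewrite m10 /coprime gcd0n => /eqP.
(* Bezout: an element killed by both [m1] and [m2] is killed by 1. *)
have [a b E _] := egcdnP m2 m1_gt0; rewrite (eqP cop) in E.
move: (congr1 (GRing.natmul (mixed g k.+1 l.+1)) E).
by rewrite mulrnDr ![(_ * m1)%N]mulnC ![(_ * m2)%N]mulnC !mulrnA t1 t2
  !mul0rn add0r mulr1n.
Qed.

End FiniteDifferences.

(** * Testing homomorphisms out of free abelian groups *)

Section HomEval.
Context (A B : zmodType) (x : A).

Definition hom_eval (f : hom A B) : B := hom_fun f x.

Lemma hom_eval_is_zmod_morphism : zmod_morphism hom_eval.
Proof. by []. Qed.

HB.instance Definition _ :=
  GRing.isZmodMorphism.Build (hom A B) B hom_eval hom_eval_is_zmod_morphism.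

End HomEval.

Lemma hom_freeg_eq0 (K : choiceType) (B : zmodType) (f : hom (C0 K) B) :
  (forall x : K, hom_fun f (<< x >> : {freeg K / int}) = 0) -> f = 0.
Proof.
move=> f0; apply: homP => D; rewrite hom_zeroE.
pose f' : {additive {freeg K / int} -> B} := f.
rewrite -[hom_fun f D]/(f' D) -[D]freeg_sumE raddf_sum big1_seq// => x _.
rewrite -[coeff x D]intz -freegU_mulz raddfMz.
by rewrite -[f' _]/(hom_fun f _) f0 mul0rz.
Qed.

(** * Vanishing of mixed differences for invariants of finite degree *)

Section Vanishing.
Context (R : realType) (n : nat) (Y : ptopologicalType).
Local Notation sphere := (sphere R n).
Local Notation zero_map := (cst_pmap sphere Y).

(** Each letter fills one band, with [a] or with the constant map. Taking [pcat zero_map] instead of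
    the identity keeps the other bands in place, so that different words can be compared point by
    point. *)
Definition pcross (V : zmodType) (a : pmap sphere Y) (k : nat)
    (F : pmap sphere Y -> V) : V :=
  cross (pcat a) (pcat zero_map) zero_map k F.

Definition depends_on (T : Type) (F : pmap sphere Y -> T) (xs : seq sphere) :=
  forall p q : pmap sphere Y, {in xs, p =1 q} -> F p = F q.

Lemma pcatE_left (a b : pmap sphere Y) s :
  right_sphere s = point -> pcat a b s = a (left_sphere s).
Proof. by apply: pcat_fun_left; rewrite !pmap_pt. Qed.

Lemma pcatE_right (a b : pmap sphere Y) s :
  left_sphere s = point -> pcat a b s = b (right_sphere s).
Proof. by apply: pcat_fun_right; rewrite !pmap_pt. Qed.

(* A point in the open left half does not see the second argument of pcat; if
   there is no such point, pcat a and pcat zero_map agree on all points. *)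
Lemma pcross_few_points (V : zmodType) (a : pmap sphere Y) k
    (F : pmap sphere Y -> V) xs :
  depends_on F xs -> (size xs < k)%N -> pcross a k F = 0.
Proof.
rewrite /pcross; elim: k F xs => // k IH F xs Fxs; rewrite ltnS => hk.
have [/allP hall|/allPn[x0 x0xs hx0]] :=
    boolP (all (fun x => left_sphere x == point) xs).
  apply/eqP; rewrite /= subr_eq0; apply/eqP/eq_cross => p /=.
  by apply: Fxs => x /hall /eqP hx; rewrite !pcatE_right.
pose ys := [seq right_sphere x | x <- rem x0 xs].
have sys : (size ys < k)%N.
  by rewrite size_map size_rem// prednK//; case: (xs) x0xs.
have Fys e : depends_on (F \o pcat e) ys.
  move=> p q pq; apply: Fxs => x xxs.
  case: (left_or_right x) => hx; first by rewrite !pcatE_left.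
  rewrite !pcatE_right//; apply/pq/map_f.
  move: xxs; rewrite (perm_mem (perm_to_rem x0xs)) inE => /predU1P[xx0|//].
  by rewrite -xx0 hx eqxx in hx0.
by rewrite /= !(IH _ ys) ?subr0.
Qed.

(** Each point of [xs] sees only one argument of the outer [pcat]. By pigeonhole, fewer than [l]
    points see [q] or fewer than [k] see [p]. *)
Lemma pcross2_few_points (V : zmodType) (a b : pmap sphere Y) k l
    (F : pmap sphere Y -> V) xs :
  depends_on F xs -> (size xs < k + l)%N ->
  pcross a k (fun p => pcross b l (fun q => F (pcat p q))) = 0.
Proof.
move=> Fxs hkl; pose P (x : sphere) := right_sphere x == point.
pose ls := [seq left_sphere x | x <- xs & P x].
pose rs := [seq right_sphere x | x <- xs & ~~ P x].
have Frs p : depends_on (fun q => F (pcat p q)) rs.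
  move=> q q' qq'; apply: Fxs => x xxs.
  have [/eqP hx|hx] := boolP (P x); first by rewrite !pcatE_left.
  case: (left_or_right x) => hx'; first by rewrite /P hx' eqxx in hx.
  by rewrite !pcatE_right//; apply/qq'/map_f; rewrite mem_filter hx.
have Fls : depends_on (fun p => pcross b l (fun q => F (pcat p q))) ls.
  move=> p p' pp'; apply: eq_cross => q; apply: Fxs => x xxs.
  have [hx|hx] := boolP (P x).
    by rewrite !pcatE_left ?(eqP hx)//; apply/pp'/map_f; rewrite mem_filter hx.
  case: (left_or_right x) => hx'; first by rewrite /P hx' eqxx in hx.
  by rewrite !pcatE_right.
have [hl|hl] := ltnP (size rs) l.
  rewrite -[RHS](cross0 (pcat a) (pcat zero_map) zero_map V k).
  by apply: eq_cross => p; exact: pcross_few_points (Frs p) hl.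
apply: pcross_few_points Fls _.
move: hkl hl; rewrite !size_map !size_filter -(count_predC P xs) => hkl hl.
by rewrite -(ltn_add2r l); exact: leq_ltn_trans (leq_add (leqnn _) hl) hkl.
Qed.

(** It suffices to evaluate at a basis element, an r-tuple [x]; the value then depends on the map
    only through its values at the entries of [x]. *)
Lemma pcross2_power_map (a b : pmap sphere Y) k l r : (r < k + l)%N ->
  pcross a k (fun p => pcross b l (fun q =>
    C0_map (@power_map sphere Y r (pcat p q)))) = 0.
Proof.
move=> hr; apply: hom_freeg_eq0 => x.
rewrite -[LHS]/(hom_eval _ _) /pcross raddf_cross.
under eq_cross => p do rewrite /= raddf_cross.
apply: (@pcross2_few_points _ a b k l
  (fun p => hom_eval _ (C0_map (power_map p)))
  (codom x)); last by rewrite size_codom card_ord.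
move=> p q pq; rewrite /hom_eval !C0_map1; congr << _ >>.
by apply/ffunP => i; rewrite !ffunE pq// codom_f.
Qed.

(** On classes [pcat zero_map] acts as the identity by the unit law, so a word matters only through
    its number of letters [pcat a]. *)
Lemma pcross_hclass (V : zmodType) (a : pmap sphere Y) k
    (F : homotopy_group R n Y -> V) :
  pcross a k (fun p => F (hclass R p)) =
  iter k (@delta V) (fun i => F (hg_natmul (hclass R a) i)) 0%N.
Proof.
rewrite -cross_nat.
rewrite -[LHS]/(pcross a k (F \o @hclass R sphere Y)) /pcross.
rewrite (@cross_morph _ _ _ _ _ (hg_add (hclass R a)) (hg_add (hg_zero R n Y))).
- rewrite -(@cross_morph _ _ S id 0%N _ _ (hg_natmul (hclass R a)))//.
  by move=> i; rewrite hg_add0r.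
- by move=> p; rewrite hg_addE.
- by move=> p; rewrite hg_addE.
Qed.

Definition hg_grid (V : Type) (f : homotopy_group R n Y -> V) u1 u2 i j : V :=
  f (hg_add (hg_natmul u1 i) (hg_natmul u2 j)).

(** The homomorphism [L] witnessing the degree carries the vanishing alternating sum in Hom to the
    mixed difference of [f]. *)
Lemma mixed_degree_eq0 (V : zmodType) (f : homotopy_group R n Y -> V) r u1 u2 :
  degree_le f r ->
  forall k l, (r < k + l)%N -> mixed (hg_grid f u1 u2) k l = 0.
Proof.
move=> [L fL] k l hr; rewrite /mixed /hg_grid.
rewrite -[u1]reprK -[u2]reprK; set a := repr u1; set b := repr u2.
rewrite -(raddf0 L) -(pcross2_power_map a b hr) /pcross raddf_cross.
rewrite -/(pcross _ _ _).
rewrite -(pcross_hclass a k (fun u => iter l (@delta V)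
  (fun j => f (hg_add u (hg_natmul (hclass R b) j))) 0%N)).
apply: eq_cross => p /=; rewrite raddf_cross.
rewrite -(pcross_hclass b l (fun v => f (hg_add (hclass R p) v))).
by apply: eq_cross => q; rewrite /= hg_addE fL.
Qed.

Lemma hg_natmul_period (u : homotopy_group R n Y) m i :
  hg_natmul u m = hg_zero R n Y -> hg_natmul u (m + i) = hg_natmul u i.
Proof. by move=> um; rewrite addnC /hg_natmul iterD -/(hg_natmul u m) um. Qed.

End Vanishing.

Theorem mainTheorem8 (R : realType) (n : nat) (n_gt1 : (1 < n)%N)
    (Y : ptopologicalType) (u1 u2 : homotopy_group R n Y) (m1 m2 : nat)
    (ord1 : hg_has_order u1 m1) (ord2 : hg_has_order u2 m2)
    (cop : coprime m1 m2)
    (V : zmodType) (f : homotopy_group R n Y -> V) (ff : finite_degree f) :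
  let w : {freeg (homotopy_group R n Y) / int} :=
    << hg_add u1 u2 >> - << u1 >> - << u2 >> + << hg_zero R n Y >> in
  freeg_ext f w = 0.
Proof.
move=> w; rewrite /w raddfD 2!raddfB /= !freeg_ext1.
have [r fr] := ff; have [_ u1m _] := ord1; have [_ u2m _] := ord2.
have g1 i j : hg_grid f u1 u2 (m1 + i) j = hg_grid f u1 u2 i j.
  by rewrite /hg_grid hg_natmul_period.
have g2 i j : hg_grid f u1 u2 i (m2 + j) = hg_grid f u1 u2 i j.
  by rewrite /hg_grid hg_natmul_period.
(* The indices 0 0 give c(1, 1), which the unit laws turn into the value of [f] on [w]. *)
have := mixed_coprime_eq0 cop g1 g2 (mixed_degree_eq0 u1 u2 fr) 0 0.
rewrite /mixed /= /delta /hg_grid /hg_natmul /= !hg_addr0 !hg_add0r.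
by rewrite opprB addrA addrAC.
Qed.
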